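(* Consider the attachment function $f(k)=(k+1)^{\alpha}$, $k\in\mathbb{N}_0$, for some $\alpha\in(1/2,1)$. Let $m_n=\lfloor1+(\log n)^{\nu}\rfloor$, $n\in\mathbb{N}$, for some $\nu>0$. Then, for any positive $\nu$, a persistent hub emerges almost surely in the random graph sequence $\{\mathcal{G}_n\}_{n\ge0}$ with attachment function $f$ and attachment sequence $\{m_n\}_{n\ge1}$.
   Context: $\mathbb{N}=\{1,2,\dots\}$, $\mathbb{N}_0=\mathbb{N}\cup\{0\}$. Model. $\mathcal{G}_0$ consists of one vertex $v_0$ and no edges. Given $\mathcal{G}_{n-1}$ (with vertices $v_0,\dots,v_{n-1}$), $\mathcal{G}_n$ is obtained by adding one vertex $v_n$ and $m_n$ edges directed away from $v_n$; the other ends of these edges are attached sequentially, each one to a vertex $v_i$, $0\le i\le n-1$, chosen with (conditional) probability $f(\deg v_i)/\sum_{j=0}^{n-1}f(\deg v_j)$, where degrees are computed immediately before that edge is attached (so they account for the edges of $v_n$ already attached). Multiple edges are allowed. Degree means in-degree plus out-degree. A persistent hub emerges if, almost surely, there is a random finite $n_0\in\mathbb{N}_0$ such that the same vertex has maximal degree in $\mathcal{G}_n$ for all $n\ge n_0$. *)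

(* Defs.v *)
(* MathComp-Analysis *)
From mathcomp Require Import all_boot all_order all_algebra.
From mathcomp Require Import all_classical all_reals all_analysis.
Set Implicit Arguments.
Unset Strict Implicit.
Unset Printing Implicit Defensive.
Import Order.TTheory GRing.Theory Num.Theory.
Local Open Scope classical_set_scope.
Local Open Scope ring_scope.

(* The vertex v_i is the natural number i; the vertices of the n-th graph are
   0, ..., n. A multigraph is given by the list of its arcs (tail, head), in the
   order in which they were added. *)
Definition multigraph := seq (nat * nat).

Definition outdeg (G : multigraph) (v : nat) : nat :=
  count (fun e => e.1 == v) G.

Definition indeg (G : multigraph) (v : nat) : nat :=
  count (fun e => e.2 == v) G.

Definition deg (G : multigraph) (v : nat) : nat := (indeg G v + outdeg G v)%N.

(* [tgt n k] is the head of the k-th edge (counted from 0) sent by vertex n;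
   only the values with 1 <= n and k < m n are used. *)
Definition new_arcs (tgt : nat -> nat -> nat) (n k : nat) : multigraph :=
  [seq (n, tgt n j) | j <- iota 0 k].

Fixpoint graph (m : nat -> nat) (tgt : nat -> nat -> nat) (n : nat) :
    multigraph :=
  if n is n'.+1 then graph m tgt n' ++ new_arcs tgt n (m n) else [::].

(* The graph seen just before vertex n (n >= 1) attaches its k-th edge. *)
Definition graph_before (m : nat -> nat) (tgt : nat -> nat -> nat)
    (n k : nat) : multigraph :=
  graph m tgt n.-1 ++ new_arcs tgt n k.

Definition attach_prob (R : realType) (f : nat -> R) (G : multigraph)
    (n i : nat) : R :=
  f (deg G i) / \sum_(0 <= j < n) f (deg G j).

Definition cond_prob d (T : measurableType d) (R : realType)
    (P : probability T R) (A B : set T) : R :=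
  fine (P (A `&` B)) / fine (P B).

(* As arcs are listed in order of insertion, the event that the current graph
   is G fixes all earlier choices: the conditioning is on the whole past. *)
Definition attachment_process d (T : measurableType d) (R : realType)
    (P : probability T R) (f : nat -> R) (m : nat -> nat)
    (X : nat -> nat -> {RV P >-> nat}) : Prop :=
  forall (n k : nat) (G : multigraph) (i : nat),
    (1 <= n)%N -> (k < m n)%N -> (i < n)%N ->
    let past := [set w | graph_before m (fun a b => X a b w) n k = G] in
    (0 < P past)%E ->
    cond_prob P [set w | X n k w = i] past = attach_prob f G n i.

Definition random_graph d (T : measurableType d) (R : realType)
    (P : probability T R) (m : nat -> nat) (X : nat -> nat -> {RV P >-> nat})
    (n : nat) (w : T) : multigraph :=
  graph m (fun a b => X a b w) n.

Definition has_max_degree (G : multigraph) (n v : nat) : Prop :=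
  (v <= n)%N /\ forall u : nat, (u <= n)%N -> (deg G u <= deg G v)%N.

Definition persistent_hub d (T : measurableType d) (R : realType)
    (P : probability T R) (G : nat -> T -> multigraph) : Prop :=
  {ae P, forall w, exists n0 v : nat,
    forall n : nat, (n0 <= n)%N -> has_max_degree (G n w) n v}.

(* Main.v *)
Require Import Defs.
From mathcomp Require Import all_boot all_order all_algebra.
From mathcomp Require Import all_classical all_reals all_analysis.
From mathcomp Require Import ring lra zify.
Local Open Scope ring_scope.
Set Implicit Arguments.
Unset Strict Implicit.
Unset Printing Implicit Defensive.
Import Order.TTheory GRing.Theory Num.Theory.
Import numFieldNormedType.Exports.

(** Vertices of the current graph compete for each new edge with probabilities
    proportional to f of their degrees. For two vertices of degrees a and b a
    function F a b of these degrees is therefore a martingale as soon as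

      f a * (F (a + 1) b - F a b) + f b * (F a (b + 1) - F a b) = 0,

    whatever the other vertices do. For each number c, real or complex, the
    product over j < a of the 1 - c / f j times the product over j < b of the
    1 + c / f j is such a function. Its diagonal values are the products of the
    1 - c ^ 2 / f j ^ 2. Since alpha > 1 / 2, the sum of the 1 / f j ^ 2
    converges, and these products have a positive finite limit for both choices
    of c to which the maximal inequality [hitting_bound] is applied below.

    c = 1 / 2, for the degrees of vertex 0 and of a late vertex i. On the event
    that i catches up with 0, F is bounded below, so the probability of this
    event is at most a constant times the mean of F when i is born. In that
    mean, the factor of vertex 0 has been decreasing at the rate 1 / (2 S),
    where S is the total weight; as S is at most of order n * (m n) ^ alpha
    during the arrival of n, this factor is at most the exponential of minus a
    constant times the sum of the (m n) ^ (1 - alpha) / n for n <= i, hence of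
    minus a constant times (m i) ^ (1 - alpha) * ln i. The factor of vertex i
    is at most the exponential of a constant times (m i) ^ (1 - alpha). The
    probabilities are thus summable, and almost surely only finitely many
    vertices ever catch up with vertex 0 ([overtakes_finitely]).

    c imaginary, for two given vertices. The real part h of F is then bounded in
    absolute value by the limit L of its increasing diagonal values. Starting
    from a tie at degree d, choose c so large that h d d <= L / 2. A tie of high
    degree, where h is close to L, must then have probability bounded away from
    1: otherwise the mean of h would exceed h d d. So ties of unbounded degree
    have probability 0 ([tied_often_negligible]), and the order of the two
    degrees is eventually constant ([pair_eventually_ordered]).

    Hence all vertices but finitely many stay below vertex 0, and the finitely
    many others are eventually in a fixed order ([eventual_leader]). *)

(** * Sums of powers *)

Section sums_of_powers.
Variable R : realType.
Implicit Types s y p : R.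

(** Discrete form of the derivative of y ^ (- s). With u = (y - 1) / y the
    claim is u ^ (- s) >= 1 + s / y, which is exp x >= 1 + x applied to
    x = - s * ln u >= s * (1 - u). *)
Lemma powRN_gap s y : 0 < s -> 1 < y ->
  s * y `^ (- (s + 1)) <= (y - 1) `^ (- s) - y `^ (- s).
Proof.
move=> s0 y1; have y0 : 0 < y by lra.
set u := (y - 1) / y.
have u0 : 0 < u by rewrite divr_gt0 // subr_gt0.
have -> : y - 1 = u * y by rewrite /u divfK // gt_eqF.
rewrite powRM ?(ltW u0) ?(ltW y0) //.
rewrite opprD powRD ?(gt_eqF y0) ?implybT // powR_inv1 ?(ltW y0) //.
have ulow : 1 + s / y <= u `^ (- s).
  rewrite /powR gt_eqF //; apply: le_trans (expR_ge1Dx _).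
  have : ln u <= u - 1 by rewrite -{1}(subrK 1 u) addrC le_ln1Dx //; lra.
  have -> : s / y = s * (1 - u) by rewrite /u; field; rewrite gt_eqF.
  by nra.
have := powR_gt0 (- s) y0; set z := y `^ (- s) => z0.
have -> : s * (z / y) = (1 + s / y) * z - z by field; rewrite gt_eqF.
by rewrite lerB // ler_wpM2r // ltW.
Qed.

(** Discrete form of the derivative of y ^ s. With u = (y - 1) / y and
    x = s / y the same argument gives u ^ s <= exp (- x) <= 1 / (1 + x); the
    factor 1 / 2 pays for bounding 1 / (1 + x) by 1 - x / 2 on [0, 1]. *)
Lemma powR_gap s y : 0 < s -> s <= 1 -> 1 <= y ->
  s / 2 * y `^ (s - 1) <= y `^ s - (y - 1) `^ s.
Proof.
move=> s0 s1 y1; have y0 : 0 < y by lra.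
rewrite powRD ?(gt_eqF y0) ?implybT // powR_inv1 ?(ltW y0) //.
have := powR_gt0 s y0; set z := y `^ s => z0.
have x1 : s / y <= 1 by rewrite ler_pdivrMr // mul1r; lra.
have x0 : 0 < s / y by rewrite divr_gt0.
suff H : (y - 1) `^ s <= (1 - s / y / 2) * z.
  rewrite lerBrDr; apply: le_trans (lerD (lexx _) H) _.
  by rewrite le_eqVlt; apply/orP; left; apply/eqP; field; rewrite gt_eqF.
have [->|ny] := eqVneq y 1.
  rewrite subrr powR0 ?gt_eqF // mulr_ge0 ?(ltW z0) //.
  by rewrite divr1; lra.
set u := (y - 1) / y.
have u0 : 0 < u by rewrite divr_gt0 // subr_gt0 lt_neqAle eq_sym ny.
have -> : y - 1 = u * y by rewrite /u divfK // gt_eqF.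
rewrite powRM ?(ltW u0) ?(ltW y0) // ler_wpM2r ?(ltW z0) //.
have lnu : ln u <= - y^-1.
  have -> : - y^-1 = u - 1 by rewrite /u; field; rewrite gt_eqF.
  by rewrite -{1}(subrK 1 u) addrC le_ln1Dx //; lra.
have : u `^ s <= expR (- (s / y)).
  by rewrite /powR gt_eqF // ler_expR -mulrN ler_wpM2l // ltW.
move=> /le_trans; apply; rewrite expRN.
have := expR_ge1Dx (s / y); set x := s / y in x0 x1 *; set e := expR x => ex.
have e0 : 0 < e by rewrite expR_gt0.
rewrite -[leLHS]mul1r ler_pdivrMr //.
apply: le_trans (_ : (1 - x / 2) * (1 + x) <= _); first by nra.
by rewrite ler_wpM2l //; lra.
Qed.

(** The bound on each term by [powRN_gap], with s = p - 1, telescopes. *)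
Lemma sum_powRN_bound p (n : nat) : 1 < p ->
  \sum_(j < n) ((j%:R + 1) `^ p)^-1 <= 1 + (p - 1)^-1.
Proof.
move=> p1; have s0 : 0 < p - 1 by lra.
have si0 : 0 < (p - 1)^-1 by rewrite invr_gt0.
case: n => [|n]; first by rewrite big_ord0; lra.
suff H : \sum_(j < n.+1) ((j%:R + 1) `^ p)^-1
    <= 1 + (p - 1)^-1 * (1 - n.+1%:R `^ (- (p - 1))).
  apply: le_trans H _; rewrite lerD2l ler_piMr ?(ltW si0) //.
elim: n => [|n IH].
  by rewrite big_ord1 add0r powR1 subrr mulr0 addr0 invr1.
rewrite big_ord_recr /=; apply: le_trans (lerD IH (lexx _)) _.
have y1 : 1 < n.+2%:R :> R by rewrite ltr1n.
have := powRN_gap s0 y1.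
rewrite subrK powRN natr1 -(@natrB _ n.+2 1) // subn1 /= => H.
have : (n.+2%:R `^ p)^-1
    <= (p - 1)^-1 * (n.+1%:R `^ (- (p - 1)) - n.+2%:R `^ (- (p - 1))).
  by rewrite mulrC ler_pdivlMr // mulrC.
by rewrite !mulrBr; lra.
Qed.

(** The bound on each term by [powR_gap] telescopes. *)
Lemma sum_powR_bound s (n : nat) : 0 < s -> s <= 1 ->
  \sum_(j < n) ((j%:R + 1) `^ (1 - s))^-1 <= 2 / s * n%:R `^ s.
Proof.
move=> s0 s1; elim: n => [|n IH].
  by rewrite big_ord0 mulr_ge0 ?powR_ge0 // divr_ge0 // ltW.
rewrite big_ord_recr /=; apply: le_trans (lerD IH (lexx _)) _.
have y1 : 1 <= n.+1%:R :> R by rewrite ler1n.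
have := powR_gap s0 s1 y1.
rewrite -(@natrB _ n.+1 1) // subn1 /= natr1 -powRN opprB => H.
have : n.+1%:R `^ (s - 1) <= 2 / s * (n.+1%:R `^ s - n%:R `^ s) :> R.
  have -> : n.+1%:R `^ (s - 1) = 2 / s * (s / 2 * n.+1%:R `^ (s - 1)) :> R.
    by field; rewrite gt_eqF.
  by rewrite ler_wpM2l // divr_ge0 // ltW.
by rewrite mulrBr; lra.
Qed.

End sums_of_powers.

(** * Elapsed time against the head start of a newborn vertex *)

Section attachment_sequence.
Variable R : realType.
Implicit Types (alpha nu s : R).

Lemma sum_inv_ge_ln (a b : nat) : (a <= b)%N ->
  ln b.+1%:R - ln a.+1%:R <= \sum_(a.+1 <= n < b.+1) n%:R^-1 :> R.
Proof.
elim: b => [|b IH].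
  by rewrite leqn0 => /eqP ->; rewrite subrr big_geq.
rewrite leq_eqVlt => /orP [/eqP ->|]; first by rewrite subrr big_geq.
rewrite ltnS => ab; rewrite big_nat_recr //=.
apply: le_trans (lerD (IH ab) (lexx _)).
have -> : b.+2%:R = (1 + b.+1%:R^-1) * b.+1%:R :> R.
  by rewrite mulrDl mul1r mulVf ?pnatr_eq0 // natr1.
have : 0 < b.+1%:R^-1 :> R by rewrite invr_gt0 ltr0n.
set x := b.+1%:R^-1 => x0.
rewrite lnM ?posrE ?ltr0n ?addr_gt0 // -addrA [leLHS]addrC lerD2l.
by rewrite le_ln1Dx //; lra.
Qed.

(** The right-hand side measures how far vertex 0 has progressed when vertex i
    arrives, and the first term on the left bounds the head start that vertex i
    gets from its m i own edges. The summands with sqrt i < n <= i are enough: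
    there ln n >= ln i / 2, so m n is at least a fixed fraction of m i, and the
    harmonic sum contributes a multiple of ln i. The right-hand side is
    therefore at least a constant times (m i) ^ (1 - alpha) * ln i, a product
    of two factors that tend to infinity, because nu > 0, and it absorbs a
    multiple of each factor. *)
Lemma ln_sequence_sum_ge alpha nu (m : nat -> nat) :
  0 < alpha < 1 -> 0 < nu ->
  (forall n : nat, (1 <= n)%N -> m n = Num.truncn (1 + (ln n%:R) `^ nu)) ->
  exists i1 : nat, (0 < i1)%N /\ forall i : nat, (i1 <= i)%N ->
    2 / (1 - alpha) * (m i)%:R `^ (1 - alpha) + 4 * ln i%:R
    <= \sum_(1 <= n < i.+1) (m n)%:R `^ (1 - alpha) / (4 * n%:R).
Proof.
move=> alpha01 nu0 mE; set s : R := 1 - alpha.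
have s0 : 0 < s by rewrite /s; lra.
have lnn_ge0 (n : nat) : (1 <= n)%N -> 0 <= ln n%:R :> R.
  by move=> n1; rewrite ln_ge0 // ler1n.
have m_up (n : nat) : (1 <= n)%N -> (m n)%:R <= 1 + (ln n%:R) `^ nu.
  by move=> n1; rewrite mE // truncn_le addr_ge0 // powR_ge0.
have m_lo (n : nat) : (1 <= n)%N -> (ln n%:R) `^ nu <= (m n)%:R.
  move=> n1; rewrite mE // -(lerD2r 1) natr1 addrC; apply/ltW/truncnS_gt.
have m_ge1 (n : nat) : (1 <= n)%N -> 1 <= (m n)%:R :> R.
  move=> n1; rewrite mE // ler1n truncn_gt0.
  by rewrite lerDl powR_ge0.
set q := (1 / 2) `^ nu : R.
have q0 : 0 < q by rewrite powR_gt0 //; lra.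
have q1 : q <= 1.
  rewrite -(powRr0 (1 / 2 : R)) /q; apply: ger_powR; last exact: ltW.
  by lra.
(* delta is a lower bound for (m n / m i) ^ s when ln n >= ln i / 2. *)
set delta := (q / 2) `^ s.
have delta0 : 0 < delta by rewrite powR_gt0 //; lra.
(* Each summand of L0 is one of the three thresholds used below on ln i. *)
set L0 := 4 + 64 / (s * delta) + (128 / delta) `^ (nu * s)^-1.
have b0 : 0 <= 64 / (s * delta) by rewrite divr_ge0 // ltW // mulr_gt0.
have b1 : 0 <= (128 / delta) `^ (nu * s)^-1 by exact: powR_ge0.
exists (Num.truncn (expR L0)).+1; split => // i hi.
set L := ln i%:R : R.
have i1 : (1 <= i)%N by apply: leq_trans hi.
have i0 : 0 < i%:R :> R by rewrite ltr0n.
have hL : L0 <= L.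
  rewrite -ler_expR /L lnK ?posrE //; apply/ltW/(lt_le_trans (truncnS_gt _)).
  by rewrite ler_nat.
have L4 : 4 <= L by rewrite /L0 in hL; lra.
have Ls : 64 / (s * delta) <= L by rewrite /L0 in hL; lra.
have Lnu : (128 / delta) `^ (nu * s)^-1 <= L by rewrite /L0 in hL; lra.
have big : 128 / delta <= (m i)%:R `^ s.
  apply: le_trans (_ : (L `^ nu) `^ s <= _); last first.
    by apply: ge0_ler_powR; rewrite ?nnegrE ?powR_ge0 ?(ltW s0) ?m_lo.
  rewrite -powRrM.
  have -> : 128 / delta = ((128 / delta) `^ (nu * s)^-1) `^ (nu * s).
    rewrite -powRrM mulVf ?powRr1 ?divr_ge0 ?(ltW delta0) //.
    by rewrite mulf_neq0 // gt_eqF.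
  apply: ge0_ler_powR; rewrite ?nnegrE // ?mulr_ge0 ?(ltW s0) ?(ltW nu0) //.
  by lra.
have near_i (n : nat) : (1 <= n)%N -> L / 2 <= ln n%:R ->
    delta * (m i)%:R `^ s <= (m n)%:R `^ s.
  move=> n1 Ln; rewrite -powRM ?ler0n //; last lra.
  apply: ge0_ler_powR; rewrite ?nnegrE ?(ltW s0) ?mulr_ge0 //; first lra.
  have h1 : q * L `^ nu <= (m n)%:R.
    apply: le_trans (m_lo _ n1); rewrite -powRM; [|lra..].
    by apply: ge0_ler_powR; rewrite ?nnegrE ?(ltW nu0) //; lra.
  have := m_ge1 n n1; have := m_up i i1; rewrite -/L.
  have := powR_ge0 L nu; set z := L `^ nu in h1 * => z0 hu hn.
  by nra.
set a := Num.truncn (Num.sqrt (i%:R : R)).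
have sq0 : 0 < Num.sqrt (i%:R : R) by rewrite sqrtr_gt0.
have sq1 : 1 <= Num.sqrt (i%:R : R) by rewrite -[leLHS]sqrtr1 ler_wsqrtr // ler1n.
have lnsq : ln (Num.sqrt (i%:R : R)) = L / 2.
  by rewrite -powR12_sqrt ?ltW // ln_powR mulrC.
have ai : (a <= i)%N.
  rewrite -(ler_nat R); apply: le_trans (_ : Num.sqrt (i%:R : R) <= _).
    by rewrite truncn_le ltW.
  rewrite -{2}(sqr_sqrtr (ltW i0)) expr2 ler_peMl // ltW //.
have harm : L / 4 <= \sum_(a.+1 <= n < i.+1) n%:R^-1.
  apply: le_trans (sum_inv_ge_ln ai).
  have h1 : L <= ln i.+1%:R by rewrite ler_ln ?posrE ?ltr0n // ler_nat.
  have h2 : ln a.+1%:R <= 1 + L / 2.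
    rewrite -lnsq; apply: le_trans (_ : ln (2 * Num.sqrt i%:R) <= _).
      rewrite ler_ln ?posrE ?ltr0n ?mulr_gt0 //.
      rewrite -natr1; have : a%:R <= Num.sqrt (i%:R : R) by rewrite truncn_le ltW.
      by lra.
    rewrite lnM ?posrE // lerD2r.
    by apply: (@le_ln1Dx R 1); lra.
  by lra.
apply: le_trans (_ : delta * (m i)%:R `^ s / 4 * (L / 4) <= _); last first.
  rewrite (@big_cat_nat _ _ _ a.+1) //=.
  apply: ler_wpDl.
    by apply: sumr_ge0 => n _; rewrite divr_ge0 ?powR_ge0 // mulr_ge0.
  apply: le_trans (_ : \sum_(a.+1 <= n < i.+1)
      delta * (m i)%:R `^ s / 4 * n%:R^-1 <= _).
    by rewrite -mulr_sumr ler_wpM2l // divr_ge0 // mulr_ge0 ?powR_ge0.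
  apply: ler_sum_nat => n /andP [an _].
  have n0 : (0 < n)%N by apply: leq_trans an.
  rewrite invfM mulrA ler_wpM2r ?invr_ge0 // ler_wpM2r ?invr_ge0 //.
  apply: near_i => //; rewrite -lnsq ler_ln ?posrE ?ltr0n //.
  by apply/ltW/(lt_le_trans (truncnS_gt _)); rewrite ler_nat.
have mu0 := powR_ge0 ((m i)%:R : R) s; set z := (m i)%:R `^ s in big mu0 *.
have h1 : 2 / s <= delta / 32 * L.
  have -> : 2 / s = delta / 32 * (64 / (s * delta)).
    by field; rewrite !gt_eqF.
  by rewrite ler_wpM2l // divr_ge0 // ltW.
have h2 : 4 <= delta / 32 * z.
  have -> : 4 = delta / 32 * (128 / delta) by field; rewrite gt_eqF.
  by rewrite ler_wpM2l // divr_ge0 // ltW.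
have L_ge0 : 0 <= L by lra.
have := ler_wpM2r mu0 h1; have := ler_wpM2r L_ge0 h2.
lra.
Qed.

End attachment_sequence.

(** * Harmonic functions of two competing degrees *)

Section urn_potentials.
Variables (R : realType) (f : nat -> R).
Hypothesis f_ge1 : forall j, 1 <= f j.

Let f_gt0 j : 0 < f j. Proof. exact: lt_le_trans ltr01 (f_ge1 j). Qed.
Let f_neq0 j : f j != 0. Proof. by rewrite gt_eqF. Qed.

(** The solution of f a * (F (a + 1) - F a) = c * F a with F 0 = 1. Hence
    growth (- c) a * growth c b is harmonic for a pair of degrees (a, b) that
    increase by one at rates f a and f b. *)
Definition growth (c : R) (a : nat) : R := \prod_(j < a) (1 + c / f j).

Lemma growthS c a : growth c a.+1 = growth c a * (1 + c / f a).
Proof. exact: big_ord_recr. Qed.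

Lemma growth_gt0 c a : -1 < c -> 0 < growth c a.
Proof.
move=> c1; apply: prodr_gt0 => j _.
rewrite -(divff (f_neq0 j)) -mulrDl divr_gt0 //.
by have := f_ge1 j; lra.
Qed.

Lemma growth_le c a b : 0 <= c -> (a <= b)%N -> growth c a <= growth c b.
Proof.
move=> c0 /subnK <-; elim: (b - a)%N => // k IH; apply: le_trans IH _.
rewrite addSn growthS ler_peMr //.
  by apply/ltW/growth_gt0; lra.
by rewrite lerDl divr_ge0 // ltW.
Qed.

Lemma growth_le_expR c a : 0 <= c ->
  growth c a <= expR (c * \sum_(j < a) (f j)^-1).
Proof.
move=> c0; rewrite mulr_sumr expR_sum; apply: ler_prod => j _.
by rewrite expR_ge1Dx andbT addr_ge0 // divr_ge0 // ltW.
Qed.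

(** On the diagonal the harmonic function with c = 1 / 2 is the product of the
    1 - x / 4 with x = 1 / f j ^ 2 in (0, 1], and each factor is at least
    exp (- x). *)
Lemma growthNM_ge (V : R) a : (forall n, \sum_(j < n) (f j ^+ 2)^-1 <= V) ->
  expR (- V) <= growth (- (1 / 2)) a * growth (1 / 2) a.
Proof.
move=> hV; rewrite -big_split /=.
apply: le_trans (_ : expR (\sum_(j < a) - (f j ^+ 2)^-1) <= _).
  by rewrite ler_expR sumrN lerN2.
rewrite expR_sum; apply: ler_prod => j _; rewrite expR_ge0 /=.
set x := (f j ^+ 2)^-1.
have x0 : 0 < x by rewrite invr_gt0 exprn_gt0.
have x1 : x <= 1 by rewrite invf_le1 ?exprn_gt0 // exprn_ege1.
have -> : (1 + - (1 / 2) / f j) * (1 + 1 / 2 / f j) = 1 - x / 4.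
  by rewrite /x; field.
rewrite expRN -[leLHS]mul1r ler_pdivrMr ?expR_gt0 //.
apply: le_trans (_ : (1 - x / 4) * (1 + x) <= _); first by nra.
by rewrite ler_wpM2l ?expR_ge1Dx //; lra.
Qed.

(** The real and imaginary parts of the solution [growth] for the imaginary
    number c = i * theta, that is of the product of the 1 + i * theta / f j. *)
Fixpoint spiral (theta : R) (a : nat) : R * R :=
  if a is j.+1 then
    let z := spiral theta j in
    (z.1 - theta / f j * z.2, z.2 + theta / f j * z.1)
  else (1, 0).

(** The real part of z times the conjugate of w. As the conjugate of [spiral]
    belongs to - i * theta, this product is harmonic too. *)
Definition inner (z w : R * R) : R := z.1 * w.1 + z.2 * w.2.

(** The squared modulus of [spiral]. *)
Definition radius (theta : R) (a : nat) : R :=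
  inner (spiral theta a) (spiral theta a).

Lemma radiusS theta a :
  radius theta a.+1 = (1 + (theta / f a) ^+ 2) * radius theta a.
Proof. by rewrite /radius /inner /=; ring. Qed.

Lemma spiral_harmonic theta a b :
  let h a b := inner (spiral theta a) (spiral theta b) in
  f a * (h a.+1 b - h a b) + f b * (h a b.+1 - h a b) = 0.
Proof. by rewrite /inner /=; field; rewrite !f_neq0. Qed.

Lemma radius_gt0 theta a : 0 < radius theta a.
Proof.
elim: a => [|a IH]; first by rewrite /radius /inner /=; lra.
by rewrite radiusS mulr_gt0 // ltr_pwDl // sqr_ge0.
Qed.

Lemma radius_nondecreasing theta : {homo radius theta : a b / (a <= b)%N >-> a <= b}.
Proof.
apply: (@homo_leq _ _ <=%R) => [//|y x z|a]; first exact: le_trans.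
by rewrite radiusS ler_peMl ?(ltW (radius_gt0 _ _)) // lerDl sqr_ge0.
Qed.

Lemma radius_le (V theta : R) a : (forall n, \sum_(j < n) (f j ^+ 2)^-1 <= V) ->
  radius theta a <= expR (theta ^+ 2 * V).
Proof.
move=> hV.
apply: le_trans (_ : expR (theta ^+ 2 * \sum_(j < a) (f j ^+ 2)^-1) <= _).
  elim: a => [|a IH].
    by rewrite big_ord0 mulr0 expR0 /radius /inner /= mul0r addr0 mul1r.
  rewrite radiusS big_ord_recr /= [in leRHS]mulrDr expRD [leLHS]mulrC.
  apply: ler_pM => //; first exact/ltW/radius_gt0.
    by rewrite addr_ge0 // sqr_ge0.
  by rewrite exprMn exprVn expR_ge1Dx.
by rewrite ler_expR ler_wpM2l // sqr_ge0.
Qed.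

Lemma inner_ge theta a b (L : R) : (forall e, radius theta e <= L) ->
  - L <= inner (spiral theta a) (spiral theta b).
Proof.
move=> hL; have := hL a; have := hL b; rewrite /radius /inner.
move: (spiral theta a) (spiral theta b) => [x y] [x' y'] /=.
have := sqr_ge0 (x + x'); have := sqr_ge0 (y + y'); nra.
Qed.

(** A nonnegative harmonic function that is at least 1 at every tie of high
    degree but at most 4 / 5 at the tie (d, d): it bounds the probability of a
    tie of high degree after (d, d). The function
    h a b = inner (spiral a) (spiral b) equals radius e at (e, e), and it stays
    between - L and L for the limit L of the increasing sequence radius. The
    affine image (h + L) / (L + radius e0) is thus nonnegative. With theta = f d
    the radius doubles between d and d + 1, so radius d <= L / 2; with
    radius e0 >= 7 L / 8 the value at (d, d) is at most
    (3 / 2) / (15 / 8) = 4 / 5. *)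
Lemma escape_potential (V : R) (d : nat) :
  (forall n, \sum_(j < n) (f j ^+ 2)^-1 <= V) ->
  exists (g : nat -> nat -> R) (e0 : nat),
  [/\ forall a b, 0 <= g a b,
      forall a b, f a * (g a.+1 b - g a b) + f b * (g a b.+1 - g a b) = 0,
      g d d <= 4 / 5
    & forall e, (e0 <= e)%N -> 1 <= g e e].
Proof.
move=> hV; set theta := f d.
set S := range (radius theta).
have S_sup : has_sup S.
  split; first by exists (radius theta 0), 0%N.
  by exists (expR (theta ^+ 2 * V)) => _ [a _ <-]; exact: radius_le.
set L := sup S.
have rL e : radius theta e <= L.
  by apply: sup_upper_bound => //; exists e.
have L0 : 0 < L by apply: lt_le_trans (rL 0%N); exact: radius_gt0.
have [_ [e0 _ <-] he0] : exists2 r, S r & L - L / 8 < r.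
  by apply: sup_adherent => //; lra.
have rd : radius theta d <= L / 2.
  have := rL d.+1; rewrite radiusS /theta divff // expr1n; lra.
set h := fun a b => inner (spiral theta a) (spiral theta b).
have D0 : 0 < L + radius theta e0 by have := radius_gt0 theta e0; lra.
exists (fun a b => (h a b + L) / (L + radius theta e0)), e0; split.
- move=> a b; rewrite divr_ge0 ?(ltW D0) //.
  by have := inner_ge a b rL; rewrite -/(h a b); lra.
- move=> a b.
  have H : f a * (h a.+1 b - h a b) + f b * (h a b.+1 - h a b) = 0.
    exact: spiral_harmonic.
  transitivity ((f a * (h a.+1 b - h a b) + f b * (h a b.+1 - h a b)) /
    (L + radius theta e0)); last by rewrite H mul0r.
  by field; rewrite gt_eqF.
- rewrite -[h d d]/(radius theta d) ler_pdivrMr //; lra.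
- move=> e e0e; rewrite -[h e e]/(radius theta e) ler_pdivlMr // mul1r.
  by have := radius_nondecreasing theta e0e; lra.
Qed.

End urn_potentials.

(** * Histories and the maximal inequality *)

Fact multigraph_code :
  {c : (multigraph -> nat) * (nat -> option multigraph) | pcancel c.1 c.2}.
Proof. by exists (@pickle (seq (nat * nat)), unpickle) => G /=; exact: pickleK. Qed.

Section history.
Variables (T : Type) (N : nat -> nat) (Y : nat -> T -> nat).

(** The process watched edge by edge: at time t vertex N t sends an edge, whose
    head is Y t. The arcs are kept in order, so a history fixes the whole past
    and its length is the time. *)
Fixpoint history (t : nat) (w : T) : multigraph :=
  if t is s.+1 then rcons (history s w) (N s, Y s w) else [::].

Lemma size_history t w : size (history t w) = t.
Proof. by elim: t => //= t IH; rewrite size_rcons IH. Qed.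

End history.

Section attachment_histories.
Local Open Scope classical_set_scope.
Variables (d : measure_display) (T : measurableType d) (R : realType).
Variables (P : probability T R) (f : nat -> R).
Variables (N : nat -> nat) (Y : nat -> T -> nat).
Implicit Types (G : multigraph) (A : set multigraph) (E : set T).

Local Notation history := (history N Y).

Definition cylinder G : set T := [set w | history (size G) w = G].

Definition extend G (i : nat) : multigraph := rcons G (N (size G), i).

Local Notation pr E := (fine (P E)).

Let code : multigraph -> nat := (sval multigraph_code).1.
Let decode : nat -> option multigraph := (sval multigraph_code).2.
Let codeK : pcancel code decode := svalP multigraph_code.

Hypothesis f_gt0 : forall k, 0 < f k.
Hypothesis N_gt0 : forall t, (0 < N t)%N.
Hypothesis mY : forall t i, measurable (Y t @^-1` [set i]).
(* The attachment rule, free of division by the probability of the past. *)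
Hypothesis stepE : forall G i, (i < N (size G))%N ->
  pr (cylinder (extend G i)) = attach_prob f G (N (size G)) i * pr (cylinder G).

Lemma cylinder_history t w : cylinder (history t w) w.
Proof. by rewrite /cylinder /= size_history. Qed.

Lemma cylinder_extend G i :
  cylinder (extend G i) = cylinder G `&` Y (size G) @^-1` [set i].
Proof.
apply/seteqP; rewrite /cylinder /extend; split => w /=; rewrite size_rcons /=.
  by move/rcons_inj => [-> ->].
by move=> [-> ->].
Qed.

Lemma measurable_history t A : measurable [set w | A (history t w)].
Proof.
have mG s G : measurable [set w | history s w = G].
  elim: s G => [|s IH] G /=.
    have [<-|nG] := pselect ([::] = G).
      by rewrite [X in measurable X](_ : _ = setT) //; apply/seteqP; split.
    by rewrite [X in measurable X](_ : _ = set0) //; apply/seteqP; split.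
  case/lastP: G => [|G [n i]].
    rewrite [X in measurable X](_ : _ = set0) //; apply/seteqP; split=> // w /=.
    by case: history.
  have [<-|nN] := pselect (N s = n).
    rewrite [X in measurable X](_ : _ =
      [set w | history s w = G] `&` Y s @^-1` [set i]); first exact: measurableI.
    by apply/seteqP; split => w /=; [move/rcons_inj => [-> ->]|move=> [-> ->]].
  rewrite [X in measurable X](_ : _ = set0) //; apply/seteqP; split=> // w /=.
  by move/rcons_inj => [].
rewrite [X in measurable X](_ : _ =
  \bigcup_(k in [set k | if decode k is Some G then A G else False])
    [set w | code (history t w) = k]).
  apply: bigcup_measurable => k; rewrite /mkset; case Ek: (decode k) => [G|//] AG.
  have [GK|nGK] := pselect (code G = k).
    rewrite [X in measurable X](_ : _ = [set w | history t w = G]) //.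
    apply/seteqP; split => w /=; last by move=> ->.
    by rewrite -GK => /(pcan_inj codeK).
  rewrite [X in measurable X](_ : _ = set0) //; apply/seteqP; split=> // w /= h.
  by apply: nGK; move: Ek; rewrite -h codeK => -[<-].
apply/seteqP; split => [w Aw|w [k]]; rewrite /mkset.
  by exists (code (history t w)); rewrite /mkset ?codeK.
by move=> + hk; rewrite -hk codeK.
Qed.

Lemma measurable_cylinder G : measurable (cylinder G).
Proof. exact: (measurable_history (size G) (eq^~ G)). Qed.
Hint Resolve measurable_cylinder : core.

Lemma measurable_hit (Q : set nat) A :
  measurable [set w | exists2 t, Q t & A (history t w)].
Proof.
rewrite [X in measurable X](_ : _ = \bigcup_(t in Q) [set w | A (history t w)]).
  by apply: bigcup_measurable => t _; exact: measurable_history.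
by apply/seteqP; split => w /= [t Qt At]; exists t.
Qed.

Let prE E : measurable E -> P E = (pr E)%:E.
Proof. by move=> mE; rewrite fineK // fin_num_measure. Qed.

Let pr_ge0 E : 0 <= pr E. Proof. exact: fine_ge0. Qed.

Let pr_le E F : measurable E -> measurable F -> E `<=` F -> pr E <= pr F.
Proof.
by move=> mE mF EF; rewrite -lee_fin -!prE // le_measure // inE.
Qed.

Let prU E F : measurable E -> measurable F -> E `&` F = set0 ->
  pr (E `|` F) = pr E + pr F.
Proof.
move=> mE mF EF; apply: EFin_inj; rewrite EFinD -!prE //; last exact: measurableU.
exact: measureU.
Qed.

Let mY_lt t n : measurable [set w | (Y t w < n)%N].
Proof.
rewrite [X in measurable X](_ : _ =
  \bigcup_(i in [set i | (i < n)%N]) Y t @^-1` [set i]).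
  exact: bigcup_measurable.
by apply/seteqP; split => [w /= h|w /= [i /= h ->]] //; exists (Y t w).
Qed.

Let mY_ge t n : measurable [set w | (n <= Y t w)%N].
Proof.
rewrite [X in measurable X](_ : _ =
  \bigcup_(i in [set i | (n <= i)%N]) Y t @^-1` [set i]).
  exact: bigcup_measurable.
by apply/seteqP; split => [w /= h|w /= [i /= h ->]] //; exists (Y t w).
Qed.

Let pr_below E t n : measurable E ->
  pr (E `&` [set w | (Y t w < n)%N]) =
  \sum_(i < n) pr (E `&` Y t @^-1` [set (i : nat)]).
Proof.
move=> mE; elim: n => [|n IH].
  rewrite big_ord0 [X in pr X](_ : _ = set0) ?measure0 //.
  by apply/seteqP; split => w //= [].
rewrite big_ord_recr /= -IH -prU; first last.
- apply/seteqP; split => // w [[_ /= lt_n] [_ /= eq_n]].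
  by move: lt_n; rewrite eq_n ltnn.
- exact: measurableI.
- exact: measurableI.
congr (pr _); apply/seteqP; split => w /=.
  by rewrite ltnS leq_eqVlt => -[Ew /orP [/eqP|]]; [right|left].
by move=> [[Ew h]|[Ew ->]]; split => //; exact: ltnW.
Qed.

Lemma attach_prob_ge0 G n i : 0 <= attach_prob f G n i.
Proof. by rewrite divr_ge0 ?(ltW (f_gt0 _)) // sumr_ge0 // => j _; exact: ltW. Qed.

Lemma total_weight_gt0 G n : (0 < n)%N -> 0 < \sum_(0 <= j < n) f (deg G j).
Proof.
case: n => // n _; rewrite big_nat_recl // ltr_pwDl // sumr_ge0 // => j _.
exact: ltW.
Qed.

Lemma sum_attach_prob G n : (0 < n)%N -> \sum_(i < n) attach_prob f G n i = 1.
Proof.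
move=> n0; rewrite -mulr_suml -(big_mkord xpredT (fun i => f (deg G i))).
by rewrite divff // gt_eqF // total_weight_gt0.
Qed.

(** The probabilities of the admissible heads add up to the probability of the
    past, which leaves nothing for the others. *)
Lemma cylinder_invalid G :
  P (cylinder G `&` [set w | (N (size G) <= Y (size G) w)%N]) = 0%E.
Proof.
set n := N (size G).
rewrite prE; last exact: measurableI.
congr EFin; apply/(addrI (pr (cylinder G `&` [set w | (Y (size G) w < n)%N]))).
rewrite addr0 -prU; [|exact: measurableI|exact: measurableI|].
  rewrite pr_below // -setIUr [X in _ `&` X](_ : _ = setT) ?setIT.
    transitivity (\sum_(i < n) attach_prob f G n i * pr (cylinder G)).
      by rewrite -mulr_suml sum_attach_prob ?mul1r // N_gt0.
    by apply: eq_bigr => i _; rewrite -cylinder_extend stepE.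
  by apply/seteqP; split => // w _ /=; case: (ltnP (Y (size G) w) n); [left|right].
apply/seteqP; split => // w [[_ /= lt_n] [_ /= ge_n]].
by move: lt_n; rewrite ltnNge ge_n.
Qed.

Lemma ae_multigraph (B : multigraph -> set T) :
  (forall G, P.-negligible (B G)) -> P.-negligible [set w | exists G, B G w].
Proof.
move=> hB; apply: (@negligibleS _ _ _ _
  (\bigcup_k (if decode k is Some G then B G else set0))).
  by move=> w [G BG]; exists (code G) => //; rewrite codeK.
apply: negligible_bigcup => k; case: (decode k) => [G|]; first exact: hB.
exact: negligible_set0.
Qed.

Lemma targets_valid : {ae P, forall w, forall t, (Y t w < N t)%N}.
Proof.
apply: ae_foralln => t; apply: (@negligibleS _ _ _ _ [set w | exists G,
  (cylinder G `&` [set w | (N (size G) <= Y (size G) w)%N]) w]).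
  move=> w /= /negP; rewrite -leqNgt => h.
  by exists (history t w); split; [exact: cylinder_history|rewrite /= size_history].
apply: ae_multigraph => G.
exists (cylinder G `&` [set w | (N (size G) <= Y (size G) w)%N]).
by split => //; [exact: measurableI|exact: cylinder_invalid].
Qed.

(** A history of positive probability occurs on a path without forbidden heads,
    so it inherits the deterministic constraints of such paths. *)
Lemma cylinder_witness G : 0 < pr (cylinder G) ->
  exists2 w, cylinder G w & forall t, (Y t w < N t)%N.
Proof.
move=> G0; apply: contrapT => none.
have : P.-negligible (cylinder G).
  apply: negligibleS targets_valid => w Gw /= valid.
  by apply: none; exists w.
by move/(negligibleP P (measurable_cylinder G)) => PG; move: G0; rewrite PG ltxx.
Qed.

Lemma cylinder_split E G : measurable E ->
  pr (E `&` cylinder G) = \sum_(i < N (size G)) pr (E `&` cylinder (extend G i)).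
Proof.
move=> mE; set n := N (size G).
under eq_bigr do rewrite cylinder_extend setIA.
rewrite -pr_below; last exact: measurableI.
have mlt : measurable (E `&` cylinder G `&` [set w | (Y (size G) w < n)%N]).
  by do 2!apply: measurableI => //.
have mge : measurable (E `&` cylinder G `\` [set w | (Y (size G) w < n)%N]).
  by apply: measurableD => //; exact: measurableI.
rewrite -{1}(setUIDK (E `&` cylinder G) [set w | (Y (size G) w < n)%N]) prU //.
  suff -> : pr (E `&` cylinder G `\` [set w | (Y (size G) w < n)%N]) = 0.
    by rewrite addr0.
  apply: EFin_inj; rewrite -prE //; apply/(negligibleP P mge).
  apply: (@negligibleS _ _ _ _
    (cylinder G `&` [set w | (N (size G) <= Y (size G) w)%N])).
    by move=> w [[_ Gw] /= /negP]; rewrite -leqNgt.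
  exists (cylinder G `&` [set w | (N (size G) <= Y (size G) w)%N]).
  by split => //; [exact: measurableI|exact: cylinder_invalid].
by rewrite setDE setIACA setICr setI0.
Qed.

(** The maximal inequality for a nonnegative supermartingale phi started at the
    history G0, in conditional form: phi G need only dominate the conditional
    probability of E at the histories G of A, which E cannot avoid. For E
    itself the event of hitting A, this asks for phi >= 1 on A. The bound for
    hitting A within k steps follows by induction on k, splitting the cylinder
    of the current history according to the next arc; then k tends to
    infinity. *)
Lemma hitting_bound E A (phi : multigraph -> R) G0 :
  measurable E ->
  (forall G, 0 <= phi G) ->
  (forall G, (size G0 <= size G)%N -> 0 < pr (cylinder G) ->
     \sum_(i < N (size G)) attach_prob f G (N (size G)) i * phi (extend G i)
       <= phi G) ->
  (forall G, (size G0 <= size G)%N -> A G ->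
     pr (E `&` cylinder G) <= phi G * pr (cylinder G)) ->
  (forall w, E w -> exists2 t, (size G0 <= t)%N & A (history t w)) ->
  pr (E `&` cylinder G0) <= phi G0 * pr (cylinder G0).
Proof.
move=> mE phi0 super onA hitE.
pose hit s k := [set w | exists2 t, (s <= t <= s + k)%N & A (history t w)].
have mhit s k : measurable (E `&` hit s k).
  by apply: measurableI => //; exact: (measurable_hit [set t | (s <= t <= s + k)%N]).
have main k G : (size G0 <= size G)%N ->
    pr (E `&` hit (size G) k `&` cylinder G) <= phi G * pr (cylinder G).
  elim: k G => [|k IH] G sG.
    have [AG|nAG] := pselect (A G).
      apply: le_trans (onA _ sG AG); apply: pr_le; try exact: measurableI.
      by move=> w [[]].
    rewrite [X in pr X](_ : _ = set0).
      by rewrite [leLHS](_ : _ = 0) ?mulr_ge0 ?pr_ge0 // measure0.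
    apply/seteqP; split => // w [[_ [t]]]; rewrite addn0 -eqn_leq => /eqP <-.
    by rewrite /cylinder => + /= Gw; rewrite Gw.
  have [AG|nAG] := pselect (A G).
    apply: le_trans (onA _ sG AG); apply: pr_le; try exact: measurableI.
    by move=> w [[]].
  have [G_gt0|G_le0] := ltP 0 (pr (cylinder G)); last first.
    apply: le_trans (_ : 0 <= _); last by rewrite mulr_ge0 ?pr_ge0.
    by apply: le_trans G_le0; apply: pr_le => //; exact: measurableI.
  rewrite cylinder_split //.
  apply: le_trans (_ : \sum_(i < N (size G))
     attach_prob f G (N (size G)) i * phi (extend G i) * pr (cylinder G) <= _).
    apply: ler_sum => i _.
    have sGi : size (extend G i) = (size G).+1 by rewrite size_rcons.
    have /IH : (size G0 <= size (extend G i))%N by rewrite sGi ltnW.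
    rewrite stepE // mulrCA mulrA; apply: le_trans.
    apply: pr_le; try exact: measurableI.
    move=> w [[Ew [t ht At]] Giw]; split => //; split => //; exists t => //.
    rewrite sGi addSnnS; case/andP: ht => ht ->; rewrite andbT ltn_neqAle ht andbT.
    apply/eqP => tG; apply: nAG; move: Giw; rewrite cylinder_extend => -[Gw _].
    by move: At; rewrite -tG Gw.
  by rewrite -mulr_suml ler_wpM2r // super.
pose F k := E `&` hit (size G0) k `&` cylinder G0.
have FU : \bigcup_k F k = E `&` cylinder G0.
  apply/seteqP; split => [w [k _ [[]]] //|w [Ew Gw]].
  have [t ht At] := hitE w Ew; exists t => //; split => //; split => //.
  by exists t => //; rewrite ht leq_addl.
have mF k : measurable (F k) by exact: measurableI.
have Fcvg : P \o F @ \oo --> P (\bigcup_k F k).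
  apply: nondecreasing_cvg_mu => //; first exact: bigcup_measurable.
  move=> k l kl; apply/subsetPset => w [[Ew [t ht At]] Gw].
  split => //; split => //; exists t => //.
  by case/andP: ht => -> /= ht; rewrite (leq_trans ht) // leq_add2l.
rewrite -FU -lee_fin -prE; last exact: bigcup_measurable.
rewrite -(cvg_lim _ Fcvg) //; apply: lime_le; first by apply/cvg_ex; eexists; exact: Fcvg.
by apply: nearW => k; rewrite /= prE // lee_fin main.
Qed.

End attachment_histories.

(** * Counting time in edges *)

Section edge_clock.
Variable m : nat -> nat.
Hypothesis m_gt0 : forall n, (0 < n)%N -> (0 < m n)%N.

Definition next_slot (p : nat * nat) : nat * nat :=
  if (p.2.+1 < m p.1)%N then (p.1, p.2.+1) else (p.1.+1, 0%N).

(** slot t = (n, k) says that the edge sent at time t is the k-th edge of vertex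
    n; both times and edges of a vertex are counted from 0, vertices that send
    edges from 1. *)
Definition slot (t : nat) : nat * nat := iter t next_slot (1%N, 0%N).

Definition sender (t : nat) : nat := (slot t).1.

Definition arcs_upto (n : nat) : nat := (\sum_(1 <= l < n.+1) m l)%N.

Lemma arcs_uptoS n : arcs_upto n.+1 = (arcs_upto n + m n.+1)%N.
Proof. by rewrite /arcs_upto big_nat_recr. Qed.

Lemma arcs_upto_lt : {mono arcs_upto : n k / (n < k)%N}.
Proof.
apply: leqW_mono; apply: leq_mono; apply: homo_ltn => [y x z|n].
  exact: ltn_trans.
by rewrite arcs_uptoS -addn1 leq_add2l m_gt0.
Qed.

Lemma arcs_upto_ge n : (n <= arcs_upto n)%N.
Proof.
elim: n => // n IH; rewrite arcs_uptoS -[n.+1]addn1.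
by rewrite leq_add // addn1 m_gt0.
Qed.

Lemma slotP t : [/\ (0 < sender t)%N, ((slot t).2 < m (sender t))%N
  & t = (arcs_upto (sender t).-1 + (slot t).2)%N].
Proof.
rewrite /sender; elim: t => [|t [n0 kn tE]] /=.
  by split => //; [exact: m_gt0|rewrite /arcs_upto big_geq].
rewrite /next_slot; case: ifP => h /=; split => //; first by rewrite addnS -tE.
  exact: m_gt0.
have -> : arcs_upto (slot t).1 = (arcs_upto (slot t).1.-1 + m (slot t).1)%N.
  by rewrite -[in LHS](prednK n0) arcs_uptoS prednK.
have -> : m (slot t).1 = (slot t).2.+1.
  by apply/eqP; rewrite eqn_leq kn andbT leqNgt h.
by rewrite addn0 addnS -tE.
Qed.

Lemma sender_leE t n : (sender t <= n)%N = (t < arcs_upto n)%N.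
Proof.
have [s0 k_lt tE] := slotP t.
have hi : (t < arcs_upto (sender t))%N.
  by rewrite -(prednK s0) arcs_uptoS {1}tE ltn_add2l prednK.
have lo : (arcs_upto (sender t).-1 <= t)%N by rewrite {2}tE leq_addr.
have up : {homo arcs_upto : a b / (a <= b)%N}.
  by move=> a b; rewrite leqNgt -arcs_upto_lt -leqNgt.
apply/idP/idP => [/up|]; first exact: leq_trans.
apply: contraLR; rewrite -ltnNge -leqNgt => nt; apply: leq_trans lo.
by apply: up; rewrite -ltnS prednK.
Qed.

Lemma slot_arcs_upto n : slot (arcs_upto n) = (n.+1, 0%N).
Proof.
have h1 : sender (arcs_upto n) = n.+1.
  apply/eqP; rewrite eqn_leq sender_leE arcs_upto_lt ltnSn /=.
  by rewrite ltnNge sender_leE ltnn.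
have [_ _ ] := slotP (arcs_upto n); rewrite h1 /= => /eqP.
rewrite -{1}[arcs_upto n]addn0 eqn_add2l => /eqP h2.
by rewrite [LHS]surjective_pairing -h2 -/(sender _) h1.
Qed.

Lemma sum_sender (R : realType) (F : nat -> R) n :
  \sum_(0 <= t < arcs_upto n) F (sender t)
  = \sum_(1 <= l < n.+1) (m l)%:R * F l.
Proof.
elim: n => [|n IH]; first by rewrite /arcs_upto !big_geq.
rewrite big_nat_recr //= -IH (@big_cat_nat _ _ _ (arcs_upto n)) //=; last first.
  by rewrite arcs_uptoS leq_addr.
congr (_ + _); rewrite arcs_uptoS.
rewrite (@eq_big_nat _ _ _ _ _ _ (fun=> F n.+1)).
  by rewrite sumr_const_nat addKn mulr_natl.
move=> t /andP [lo hi]; congr F; apply/eqP.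
by rewrite eqn_leq sender_leE arcs_uptoS hi ltnNge sender_leE -leqNgt.
Qed.

Section graph_of_history.
Variables (T : Type) (X : nat -> nat -> T -> nat).

Definition arc_target (t : nat) (w : T) : nat := X (slot t).1 (slot t).2 w.

(** When vertex n has sent its last edge the clock moves to (n + 1, 0); the
    graph does not change then, as vertex n + 1 has no arc yet. *)
Lemma history_graph_before t w : history sender arc_target t w =
  graph_before m (fun a b => X a b w) (slot t).1 (slot t).2.
Proof.
elim: t => //= t ->; have [n0 k_lt _] := slotP t.
move: n0 k_lt; rewrite /sender /arc_target /graph_before.
case: (slot t) => n k /= n0 k_lt.
have new : rcons (graph m (fun a b => X a b w) n.-1 ++
    new_arcs (fun a b => X a b w) n k) (n, X n k w) =
    graph m (fun a b => X a b w) n.-1 ++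
    new_arcs (fun a b => X a b w) n k.+1.
  by rewrite rcons_cat /new_arcs -addn1 iotaD map_cat /= cats1.
rewrite /next_slot /=; case: ifP => h /=; rewrite new //.
have -> : k.+1 = m n by apply/eqP; rewrite eqn_leq k_lt leqNgt h.
by rewrite /new_arcs /= cats0 -[in RHS](prednK n0) /= prednK.
Qed.

Lemma history_graph n w :
  history sender arc_target (arcs_upto n) w = graph m (fun a b => X a b w) n.
Proof.
by rewrite history_graph_before slot_arcs_upto /graph_before /= cats0.
Qed.

End graph_of_history.

End edge_clock.

(** * Degrees along a history *)

Section degrees.
Variables (T : Type) (N : nat -> nat) (Y : nat -> T -> nat).
Implicit Types G : multigraph.

Lemma deg_extend G l v :
  deg (extend N G l) v = (deg G v + (l == v) + (N (size G) == v))%N.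
Proof.
rewrite /deg /indeg /outdeg /extend -cats1 !count_cat /= !addn0.
by rewrite addnACA addnA.
Qed.

Lemma history_extend t w :
  history N Y t.+1 w = extend N (history N Y t w) (Y t w).
Proof. by rewrite /extend /= size_history. Qed.

Lemma deg_historyS t w v : deg (history N Y t.+1 w) v =
  (deg (history N Y t w) v + (Y t w == v) + (N t == v))%N.
Proof. by rewrite history_extend deg_extend size_history. Qed.

Lemma deg_history_homo w v :
  {homo (fun t => deg (history N Y t w) v) : s t / (s <= t)%N}.
Proof.
apply: homo_leq => [//|x y z|t]; first exact: leq_trans.
by rewrite deg_historyS -addnA leq_addr.
Qed.

Lemma sum_deg_le G n : (\sum_(0 <= j < n) deg G j <= 2 * size G)%N.
Proof.
have one x : (\sum_(0 <= j < n) (x == j) <= 1)%N.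
  elim: n => [|n IH]; first by rewrite big_geq.
  rewrite big_nat_recr //=; have [->|_] := eqVneq x n; last by rewrite addn0.
  rewrite addn1 ltnS leqn0; apply/eqP.
  by rewrite big_nat big1 // => j /andP [_ jn]; rewrite gtn_eqF.
elim: G => [|e G IH]; first by rewrite big1.
have degE j : deg (e :: G) j = ((e.2 == j) + (e.1 == j) + deg G j)%N.
  by rewrite /deg /indeg /outdeg /= addnACA.
under eq_bigr do rewrite degE.
rewrite big_split /= mulnS; apply: leq_add => //.
by rewrite big_split; exact: (leq_add (one _) (one _)).
Qed.

End degrees.

Section one_step_drift.
Variables (R : realType) (f : nat -> R) (N : nat -> nat).
Hypothesis f_gt0 : forall k, 0 < f k.
Implicit Types G : multigraph.

Let weight G := \sum_(0 <= j < N (size G)) f (deg G j).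

(** The attachment probabilities share the denominator, so the drift of a
    function of the degrees of some present vertices depends on these degrees
    only, up to a common change of speed. *)
Lemma drift G i (F : nat -> R) : (i < N (size G))%N ->
  let a := deg G i in
  \sum_(l < N (size G)) attach_prob f G (N (size G)) l * F (deg (extend N G l) i)
  = F a + f a * (F a.+1 - F a) / weight G.
Proof.
move=> iN a; set n := N (size G) in iN *.
have n0 : (0 < n)%N by apply: leq_ltn_trans iN.
transitivity (\sum_(l < n) (attach_prob f G n l * F a +
    attach_prob f G n l * (F (deg (extend N G l) i) - F a))).
  by apply: eq_bigr => l _; rewrite -mulrDr addrC subrK.
rewrite big_split /= -mulr_suml sum_attach_prob // mul1r; congr (_ + _).
rewrite (bigD1 (Ordinal iN)) //= big1 => [|l li].
  rewrite addr0 deg_extend eqxx addn1 (gtn_eqF iN) addn0 /attach_prob -/a.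
  by rewrite mulrAC.
have nli : ((l : nat) == i) = false by apply: contraNF li => /eqP li; exact/eqP/val_inj.
by rewrite deg_extend nli (gtn_eqF iN) !addn0 subrr mulr0.
Qed.

Lemma drift2 G i j (F : nat -> nat -> R) : i != j ->
  (i < N (size G))%N -> (j < N (size G))%N ->
  let a := deg G i in let b := deg G j in
  \sum_(l < N (size G)) attach_prob f G (N (size G)) l *
      F (deg (extend N G l) i) (deg (extend N G l) j)
  = F a b + (f a * (F a.+1 b - F a b) + f b * (F a b.+1 - F a b)) / weight G.
Proof.
move=> ij iN jN a b; set n := N (size G) in iN jN *.
have n0 : (0 < n)%N by apply: leq_ltn_trans iN.
transitivity (\sum_(l < n) (attach_prob f G n l * F a b + attach_prob f G n l *
    (F (deg (extend N G l) i) (deg (extend N G l) j) - F a b))).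
  by apply: eq_bigr => l _; rewrite -mulrDr addrC subrK.
rewrite big_split /= -mulr_suml sum_attach_prob // mul1r; congr (_ + _).
have ord_eq (l : 'I_n) k (kn : (k < n)%N) : ((l : nat) == k) = (l == Ordinal kn).
  by rewrite -val_eqE.
rewrite (bigD1 (Ordinal iN)) //= (bigD1 (Ordinal jN)) /=; last first.
  by rewrite -val_eqE /= eq_sym.
rewrite big1 => [|l /andP [li lj]].
  rewrite !deg_extend /= !eqxx (eq_sym j i) (negbTE ij).
  rewrite (gtn_eqF iN) (gtn_eqF jN) !addn0 !addn1 /attach_prob -/a -/b addr0.
  by rewrite mulrDl; congr (_ + _); rewrite mulrAC.
rewrite !deg_extend !ord_eq (negbTE li) (negbTE lj).
by rewrite (gtn_eqF iN) (gtn_eqF jN) !addn0 subrr mulr0.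
Qed.

End one_step_drift.

(** * Two given vertices are eventually ordered *)

Lemma bounded_eventually_constant (a : nat -> nat) (e : nat) :
  {homo a : s t / (s <= t)%N} -> (forall t, (a t <= e)%N) ->
  exists s, forall t, (s <= t)%N -> a t = a s.
Proof.
move=> a_homo a_le.
pose Q v := `[< exists t, a t = v >].
have Q0 : exists v, Q v by exists (a 0%N); apply/asboolP; exists 0%N.
have Qe v : Q v -> (v <= e)%N by move=> /asboolP [t <-].
case: (ex_maxnP Q0 Qe) => v /asboolP [s <-] v_max; exists s => t st.
apply/eqP; rewrite eqn_leq (a_homo _ _ st) andbT v_max //.
by apply/asboolP; exists t.
Qed.

(** If ties stop, the order of a and b cannot change any more, since the two
    sequences never move at the same time. If ties go on, then their values are
    bounded, so a and b are bounded and eventually constant. *)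
Lemma eventually_ordered (a b : nat -> nat) (t0 e : nat) :
  {homo a : s t / (s <= t)%N} -> {homo b : s t / (s <= t)%N} ->
  (forall t, (t0 <= t)%N -> (a t.+1 + b t.+1 <= (a t + b t).+1)%N) ->
  (forall t, (t0 <= t)%N -> (e <= t)%N -> a t = b t -> (a t <= e)%N) ->
  exists s, (forall t, (s <= t)%N -> (a t <= b t)%N) \/
            (forall t, (s <= t)%N -> (b t <= a t)%N).
Proof.
move=> a_homo b_homo step tie_le.
have [ties|] := pselect (forall s, exists2 t, (s <= t)%N & a t = b t).
  have common t : exists2 r, (t <= r)%N & a r = b r /\ (a r <= e)%N.
    have [r hr abr] := ties (maxn t (maxn t0 e)); move: hr.
    by rewrite !geq_max => /and3P [tr t0r er]; exists r => //; split=> //; exact: tie_le.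
  have a_le t : (a t <= e)%N.
    by have [r tr [_ ar]] := common t; apply: leq_trans ar; exact: a_homo.
  have b_le t : (b t <= e)%N.
    have [r tr [abr ar]] := common t; apply: leq_trans ar; rewrite abr.
    exact: b_homo.
  have [s1 as1] := bounded_eventually_constant a_homo a_le.
  have [s2 bs2] := bounded_eventually_constant b_homo b_le.
  exists (maxn s1 s2).
  have [h|h] := leqP (a s1) (b s2); [left|right] => t;
    rewrite geq_max => /andP [h1 h2]; rewrite as1 // bs2 //; exact: ltnW.
move=> /existsNP [s none].
have neq t : (maxn s t0 <= t)%N -> a t != b t.
  rewrite geq_max => /andP [st _]; apply/eqP => ab; apply: none; by exists t.
have keep (c d : nat -> nat) : {homo d : s t / (s <= t)%N} ->
    {homo c : s t / (s <= t)%N} ->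
    (forall t, (t0 <= t)%N -> (c t.+1 + d t.+1 <= (c t + d t).+1)%N) ->
    (forall t, (maxn s t0 <= t)%N -> c t != d t) ->
    (c (maxn s t0) < d (maxn s t0))%N ->
    forall t, (maxn s t0 <= t)%N -> (c t <= d t)%N.
  move=> d_homo c_homo stp ne lt0 t /subnK <-; apply: ltnW.
  elim: (t - _)%N => // k IH; rewrite addSn.
  set u := (k + maxn s t0)%N in IH *.
  have t0u : (t0 <= u)%N by rewrite /u (leq_trans (leq_maxr s t0)) // leq_addl.
  have neu : c u.+1 != d u.+1.
    by apply: ne; rewrite -addSn leq_addl.
  have := stp u t0u; have := d_homo u u.+1 (leqnSn u).
  have := c_homo u u.+1 (leqnSn u); move: neu IH; lia.
exists (maxn s t0); have := neq _ (leqnn _); rewrite neq_ltn => /orP [lt|gt].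
  by left; exact: keep.
right; apply: keep => // t h; last by rewrite eq_sym neq.
by rewrite addnC [X in (_ <= X.+1)%N]addnC step.
Qed.

Section pair_of_vertices.
Local Open Scope classical_set_scope.
Variables (d : measure_display) (T : measurableType d) (R : realType).
Variables (P : probability T R) (f : nat -> R).
Variables (N : nat -> nat) (Y : nat -> T -> nat).
Implicit Types (G : multigraph).

Local Notation pr E := (fine (P E)).
Local Notation history := (history N Y).
Local Notation cylinder := (cylinder N Y).

Hypothesis f_ge1 : forall k, 1 <= f k.
Hypothesis N_gt0 : forall t, (0 < N t)%N.
Hypothesis mY : forall t i, measurable (Y t @^-1` [set i]).
Hypothesis stepE : forall G i, (i < N (size G))%N ->
  pr (cylinder (extend N G i)) = attach_prob f G (N (size G)) i * pr (cylinder G).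
Variable V : R.
Hypothesis f_sum : forall n, \sum_(j < n) (f j ^+ 2)^-1 <= V.

Variables (i j t0 : nat).
Hypothesis ij : i != j.
Hypothesis iN : forall t, (t0 <= t)%N -> (i < N t)%N.
Hypothesis jN : forall t, (t0 <= t)%N -> (j < N t)%N.

Let f_gt0 k : 0 < f k. Proof. exact: lt_le_trans ltr01 (f_ge1 k). Qed.

(** The threshold e on the common degree is there because the potential
    of [escape_potential] is known to be at least 1 only at high ties. *)
Definition tied (e : nat) : set multigraph :=
  [set G | (t0 <= size G)%N /\ deg G i = deg G j /\ (e <= deg G i)%N].

Definition tied_often : set T :=
  [set w | forall e, exists2 t, (e <= t)%N & tied e (history t w)].

Lemma measurable_tied_often : measurable tied_often.
Proof.
rewrite [X in measurable X](_ : _ = \bigcap_e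
    [set w | exists2 t, (e <= t)%N & tied e (history t w)]).
  apply: bigcap_measurableType => e _.
  by apply: (measurable_hit N mY [set t | (e <= t)%N] (tied e)).
by apply/seteqP; split => [w h e _ //|w h e]; exact: h.
Qed.

(** From any tie the conditional probability of a later tie of high degree is
    at most 4 / 5, and every tie is a fresh start. *)
Lemma tied_often_le k G : tied 0 G ->
  pr (tied_often `&` cylinder G) <= (4 / 5) ^+ k * pr (cylinder G).
Proof.
have mT := measurable_tied_often.
elim: k G => [|k IH] G [tG [tie _]].
  rewrite expr0 mul1r -lee_fin !fineK ?fin_num_measure //; first last.
  - exact: measurableI (measurable_cylinder N mY _).
  - exact: (measurable_cylinder N mY).
  apply: le_measure; rewrite ?inE; last exact: subIsetr.
    exact: measurableI (measurable_cylinder N mY _).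
  exact: (measurable_cylinder N mY).
have [g [e0 [g_ge0 g_harm g_dd g_tie]]] := escape_potential f_ge1 (deg G i) f_sum.
have p_ge0 n : 0 <= (4 / 5) ^+ n :> R by rewrite exprn_ge0.
pose phi G' := (4 / 5) ^+ k * g (deg G' i) (deg G' j).
apply: le_trans (_ : phi G * pr (cylinder G) <= _); last first.
  rewrite ler_wpM2r ?fine_ge0 // exprSr /phi -tie.
  by rewrite ler_wpM2l.
apply: (hitting_bound f_gt0 N_gt0 mY stepE (A := tied e0)) => //.
- by move=> G'; rewrite mulr_ge0.
- move=> G' sG' _; under eq_bigr do rewrite mulrCA.
  rewrite -mulr_sumr drift2 //; [|exact/iN/(leq_trans tG)|exact/jN/(leq_trans tG)].
  by rewrite g_harm mul0r addr0.
- move=> G' sG' [tG' [tie' eG']]; apply: le_trans (IH _ _) _ => //.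
  rewrite ler_wpM2r ?fine_ge0 // /phi ler_peMr //.
  by rewrite -tie' g_tie.
- move=> w /(_ (maxn e0 (size G))) [t ht [t0t [tie' eG']]].
  move: ht eG'; rewrite !geq_max => /andP [_ st] /andP [eG' _].
  by exists t.
Qed.

Lemma tied_often_negligible : P.-negligible tied_often.
Proof.
apply: (@negligibleS _ _ _ _
    [set w | exists G, [set w | tied 0 G /\ (tied_often `&` cylinder G) w] w]).
  move=> w Ew; have [t _ [tt [tie _]]] := Ew 0%N.
  exists (history t w); split; first by split.
  by split => //; exact: cylinder_history.
apply: ae_multigraph => G.
have [tG|ntG] := pselect (tied 0 G); last first.
  apply: negligibleS (negligible_set0 P).
  by move=> w [].
have mE : measurable (tied_often `&` cylinder G).
  by apply: measurableI; [exact: measurable_tied_often|exact: (measurable_cylinder N mY)].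
apply: (@negligibleS _ _ _ _ (tied_often `&` cylinder G)); first by move=> w [].
apply/(negligibleP P mE).
rewrite -[LHS]fineK ?fin_num_measure //; congr EFin; apply/eqP.
rewrite eq_le fine_ge0 // andbT.
have cvg0 : (4 / 5) ^+ n * pr (cylinder G) @[n --> \oo] --> (0 : R).
  rewrite -[X in _ --> X](mul0r (pr (cylinder G))); apply: cvgMl.
  by apply: cvg_expr; rewrite ger0_norm; lra.
rewrite -(cvg_lim _ cvg0) //; apply: limr_ge; first by apply/cvg_ex; exists 0.
by apply: nearW => k; exact: tied_often_le.
Qed.

Lemma pair_eventually_ordered : {ae P, forall w, exists s,
  (forall t, (s <= t)%N -> (deg (history t w) i <= deg (history t w) j)%N) \/
  (forall t, (s <= t)%N -> (deg (history t w) j <= deg (history t w) i)%N)}.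
Proof.
apply: negligibleS tied_often_negligible => w /= never e.
apply: contrapT => none; apply: never.
apply: (@eventually_ordered _ _ t0 e); try exact: deg_history_homo.
  move=> t t0t; rewrite !deg_historyS (gtn_eqF (iN t0t)) (gtn_eqF (jN t0t)) !addn0.
  rewrite addnACA -[leqRHS]addn1 leq_add2l.
  by have [->|] := eqVneq (Y t w) i; rewrite ?(negbTE ij) //= add0n leq_b1.
move=> t t0t et tie; rewrite leqNgt; apply/negP => lt_e; apply: none.
by exists t => //; split; rewrite ?size_history //; split => //; exact: ltnW.
Qed.

End pair_of_vertices.

(** * Only finitely many vertices overtake vertex 0 *)

Section late_vertices.
Local Open Scope classical_set_scope.
Variables (d : measure_display) (T : measurableType d) (R : realType).
Variables (P : probability T R) (f : nat -> R) (alpha : R).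
Variables (m : nat -> nat) (X : nat -> nat -> T -> nat).
Implicit Types (G : multigraph).

Local Notation pr E := (fine (P E)).
Local Notation N := (sender m).
Local Notation Y := (arc_target m X).
Local Notation history := (history N Y).
Local Notation cylinder := (cylinder N Y).

Hypothesis alpha01 : 0 < alpha < 1.
Hypothesis fE : forall k, f k = (k%:R + 1) `^ alpha.
Hypothesis m_gt0 : forall n, (0 < n)%N -> (0 < m n)%N.
Hypothesis m_homo : forall l n, (0 < l)%N -> (l <= n)%N -> (m l <= m n)%N.
Hypothesis mY : forall t i, measurable (Y t @^-1` [set i]).
Hypothesis stepE : forall G i, (i < N (size G))%N ->
  pr (cylinder (extend N G i)) = attach_prob f G (N (size G)) i * pr (cylinder G).
Variable V : R.
Hypothesis f_sum : forall n, \sum_(j < n) (f j ^+ 2)^-1 <= V.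

Let alpha_gt0 : 0 < alpha. Proof. by case/andP: alpha01. Qed.
Let alpha_lt1 : alpha < 1. Proof. by case/andP: alpha01. Qed.

Let f_ge1 k : 1 <= f k.
Proof.
rewrite fE -[leLHS](powRr0 (k%:R + 1)); apply: ler_powR.
  by rewrite lerDr.
exact: ltW.
Qed.
Let f_gt0 k : 0 < f k. Proof. exact: lt_le_trans ltr01 (f_ge1 k). Qed.
Let N_gt0 t : (0 < N t)%N. Proof. by case: (slotP m_gt0 t). Qed.

Lemma arcs_upto_le n : (arcs_upto m n <= n * m n)%N.
Proof.
case: n => [|n]; first by rewrite /arcs_upto big_geq.
rewrite /arcs_upto; apply: leq_trans (_ : \sum_(1 <= l < n.+2) m n.+1 <= _)%N.
  rewrite big_nat [leqRHS]big_nat; apply: leq_sum => l /andP [l0 ln].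
  exact: m_homo.
by rewrite sum_nat_const_nat subn1.
Qed.

Definition weight_bound (n : nat) : R := 4 * n%:R * (m n)%:R `^ alpha.

(** The average degree is at most 2 * m n, as m is nondecreasing. Concavity of f
    enters through y ^ alpha <= x ^ alpha * (1 + y / x) with x = m n. *)
Lemma total_weight_le G :
  \sum_(0 <= j < N (size G)) f (deg G j) <= weight_bound (N (size G)).
Proof.
set n := N (size G); have n0 : (0 < n)%N by exact: N_gt0.
set x := (m n)%:R : R; have x1 : 1 <= x by rewrite /x ler1n m_gt0.
have x0 : 0 < x by lra.
have xa0 : 0 < x `^ alpha by exact: powR_gt0.
have one (y : R) : 0 < y -> y `^ alpha <= x `^ alpha * (1 + y / x).
  move=> y0; have yx0 : 0 < y / x by rewrite divr_gt0.
  have [yx|xy] := leP y x.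
    apply: le_trans (_ : x `^ alpha <= _); last by rewrite ler_peMr ?(ltW xa0) //; lra.
    by apply: ge0_ler_powR; rewrite ?nnegrE ?(ltW x0) ?(ltW y0) ?(ltW alpha_gt0).
  rewrite -{1}(divfK (lt0r_neq0 x0) y) powRM ?(ltW x0) ?(ltW yx0) // mulrC.
  rewrite ler_wpM2l ?(ltW xa0) //.
  apply: le_trans (_ : y / x <= _); last lra.
  by apply: ler1_powR; [rewrite ler_pdivlMr // mul1r ltW|exact: ltW].
apply: le_trans (_ : \sum_(0 <= j < n)
    x `^ alpha * (1 + ((deg G j)%:R + 1) / x) <= _).
  by apply: ler_sum_nat => j _; rewrite fE one // ltr_wpDl.
rewrite -mulr_sumr /weight_bound mulrC ler_wpM2r ?(ltW xa0) //.
rewrite big_split /= -mulr_suml big_split /= !sumr_const_nat subn0.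
have degs : \sum_(0 <= j < n) (deg G j)%:R <= 2 * (n%:R * x).
  rewrite -natr_sum -natrM -natrM ler_nat.
  apply: leq_trans (sum_deg_le G n) _; rewrite leq_mul2l /=.
  by apply: leq_trans (arcs_upto_le n); rewrite ltnW // -sender_leE.
have n_le : n%:R <= n%:R * x by rewrite ler_peMr.
rewrite -lerBrDl ler_pdivrMr //.
by rewrite -/(n%:R); nra.
Qed.

(** Until vertex i is complete its degree only counts its own edges, and it
    sends these from time arcs_upto (i - 1) on. *)
Lemma newborn_deg_le w i t : (forall s, (Y s w < N s)%N) ->
  (t <= arcs_upto m i)%N -> (deg (history t w) i <= t - arcs_upto m i.-1)%N.
Proof.
move=> valid; elim: t => [|t IH] ti; first by [].
have Ni : (N t <= i)%N by rewrite sender_leE.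
have := IH (ltnW ti); rewrite deg_historyS (ltn_eqF (leq_trans (valid t) Ni)) addn0.
have [Nt|nN] := eqVneq (N t) i; last first.
  by rewrite addn0 => /leq_trans; apply; rewrite leq_sub2r.
have : (arcs_upto m i.-1 <= t)%N.
  by rewrite leqNgt -sender_leE // -Nt -ltnS prednK ?N_gt0 // ltnn.
by move=> h1 h2; rewrite subSn // addn1 ltnS.
Qed.

Lemma newborn_extend_deg_le i l G : 0 < pr (cylinder G) ->
  (size G).+1 = arcs_upto m i -> (l < N (size G))%N ->
  (deg (extend N G l) i <= m i)%N.
Proof.
move=> /(cylinder_witness f_gt0 N_gt0 mY stepE) [w Gw valid] Gi lN.
have i0 : (0 < i)%N by case: i Gi => //; rewrite /arcs_upto big_geq.
have Mi : arcs_upto m i = (arcs_upto m i.-1 + m i)%N.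
  by rewrite -[in LHS](prednK i0) arcs_uptoS prednK.
have := newborn_deg_le valid (t := size G) (i := i); rewrite -Gi Gw => /(_ (leqnSn _)).
have Ni : (N (size G) <= i)%N by rewrite sender_leE // -Gi.
rewrite deg_extend (ltn_eqF (leq_trans lN Ni)) addn0.
have := m_gt0 i0; case: (N (size G) == i); lia.
Qed.

Let u := growth f (- (1 / 2)).
Let v := growth f (1 / 2).
Let kappa := expR (- V).

Let kappa_gt0 : 0 < kappa. Proof. exact: expR_gt0. Qed.
Let u_gt0 a : 0 < u a. Proof. by apply: growth_gt0 => //; lra. Qed.
Let v_gt0 a : 0 < v a. Proof. by apply: growth_gt0 => //; lra. Qed.

Let v_le a b : (a <= b)%N -> v a <= v b.
Proof. by apply: growth_le => //; lra. Qed.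

Definition overtakes (i : nat) : set T :=
  [set w | exists2 t, (arcs_upto m i <= t)%N &
    (deg (history t w) 0 <= deg (history t w) i)%N].

Lemma measurable_overtakes i : measurable (overtakes i).
Proof.
exact: (measurable_hit N mY [set t | (arcs_upto m i <= t)%N]
  [set G | (deg G 0 <= deg G i)%N]).
Qed.

Definition clock_from (i t : nat) : R :=
  \sum_(t <= s < arcs_upto m i) (weight_bound (N s))^-1.

(** From time arcs_upto i on, u (deg 0) * v (deg i) is a martingale, and it is
    at least kappa once vertex i has caught up. Before that time u (deg 0)
    decreases in mean by the factor 1 - 1 / (2 S) <= exp (- 1 / (2 S)) at each
    edge, where S is the total weight; compensating for that factor with the
    deterministic bound on S gives a supermartingale from time 0 on, and its
    initial value is the bound. *)
Lemma overtakes_le i : (0 < i)%N ->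
  pr (overtakes i) <= v (m i) / kappa * expR (- (1 / 2 * clock_from i 0)).
Proof.
move=> i0.
pose e t := expR (- (1 / 2 * clock_from i t)).
pose phi G := if (size G < arcs_upto m i)%N
  then u (deg G 0) * (v (m i) / kappa) * e (size G)
  else u (deg G 0) * v (deg G i) / kappa.
have K_ge0 : 0 <= v (m i) / kappa by rewrite divr_ge0 // ltW.
have e_ge0 t : 0 <= e t by exact: expR_ge0.
have phi_ge0 G : 0 <= phi G.
  rewrite /phi; case: ifP => _; first exact: (mulr_ge0 (mulr_ge0 (ltW (u_gt0 _)) K_ge0)).
  exact: (divr_ge0 (mulr_ge0 (ltW (u_gt0 _)) (ltW (v_gt0 _))) (ltW kappa_gt0)).
have phi_nil : phi [::] = v (m i) / kappa * e 0%N.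
  rewrite /phi /= (leq_trans i0 (arcs_upto_ge m_gt0 i)) /u /growth.
  by rewrite big_ord0 mul1r.
have cyl_nil : cylinder [::] = setT by apply/seteqP; split.
have : pr (overtakes i `&` cylinder [::]) <= phi [::] * pr (cylinder [::]).
  apply: (hitting_bound f_gt0 N_gt0 mY stepE
    (A := [set G | (arcs_upto m i <= size G)%N /\ (deg G 0 <= deg G i)%N])).
  - exact: measurable_overtakes.
  - exact: phi_ge0.
  - move=> G _ G_gt0; set t := size G.
    have sE l : size (extend N G l) = t.+1 by rewrite size_rcons.
    have [ti|it] := ltnP t (arcs_upto m i); last first.
      rewrite /phi -/t ltnNge it /=.
      under eq_bigr do rewrite sE ltnNge (leqW it) /= mulrA.
      have iN : (i < N t)%N by rewrite ltnNge sender_leE // -leqNgt.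
      rewrite -mulr_suml ler_wpM2r ?invr_ge0 ?(ltW kappa_gt0) //.
      have harmonic a b : f a * (u a.+1 * v b - u a * v b) +
          f b * (u a * v b.+1 - u a * v b) = 0.
        by rewrite /u /v !growthS; field; rewrite !gt_eqF.
      rewrite (drift2 f_gt0 (fun a b => u a * v b)) //; last first.
        by rewrite eq_sym -lt0n.
      by rewrite harmonic mul0r addr0.
    (* Equality, except when the next arc completes vertex i: then v (m i)
       dominates v of the actual degree. *)
    have next l : (l < N t)%N -> phi (extend N G l) <=
        u (deg (extend N G l) 0) * (v (m i) / kappa) * e t.+1.
      move=> lN; rewrite /phi sE; case: ltnP => // it.
      have ti1 : t.+1 = arcs_upto m i by apply/eqP; rewrite eqn_leq ti it.
      rewrite /e /clock_from ti1 big_geq // mulr0 oppr0 expR0 mulr1.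
      rewrite -mulrA ler_wpM2l ?(ltW (u_gt0 _)) //.
      rewrite ler_wpM2r ?invr_ge0 ?(ltW kappa_gt0) // v_le //.
      exact: newborn_extend_deg_le.
    apply: le_trans (_ : \sum_(l < N t) attach_prob f G (N t) l *
        u (deg (extend N G l) 0) * ((v (m i) / kappa) * e t.+1) <= _).
      apply: ler_sum => l _; rewrite -mulrA mulrA.
      by rewrite -[leRHS]mulrA ler_wpM2l ?attach_prob_ge0 // mulrA next.
    rewrite -mulr_suml (drift f_gt0 u) // /phi -/t ti.
    have -> : e t = expR (- (1 / 2 * (weight_bound (N t))^-1)) * e t.+1.
      by rewrite /e /clock_from (big_ltn ti) mulrDr opprD expRD.
    set S := \sum_(0 <= j < _) _; set a := deg G 0.
    have S0 : 0 < S by exact: total_weight_gt0.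
    have S_le : S <= weight_bound (N t) by exact: total_weight_le.
    have -> : u a + f a * (u a.+1 - u a) / S = u a * (1 - 1 / 2 * S^-1).
      by rewrite /u growthS; field; rewrite !gt_eqF.
    have decay : 1 - 1 / 2 * S^-1 <= expR (- (1 / 2 * (weight_bound (N t))^-1)).
      apply: le_trans (expR_ge1Dx _); rewrite lerD2l lerN2 ler_wpM2l //; last first.
        by rewrite lef_pV2 ?posrE // (lt_le_trans S0).
    set K := v (m i) / kappa in K_ge0 *; set D := 1 - _ in decay *.
    rewrite [leLHS](_ : _ = u a * (K * (D * e t.+1))); last by ring.
    rewrite -[leRHS]mulrA; apply: ler_wpM2l; first exact: ltW.
    by apply: ler_wpM2l => //; exact: ler_wpM2r.
  - move=> G _ [iG d0i]; rewrite -[leLHS]mul1r.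
    apply: le_trans (_ : pr (cylinder G) <= _).
      rewrite mul1r -lee_fin !fineK ?fin_num_measure //; first last.
      + exact: measurableI (measurable_overtakes i) (measurable_cylinder N mY G).
      + exact: (measurable_cylinder N mY).
      apply: le_measure; rewrite ?inE; last exact: subIsetr.
        exact: measurableI (measurable_overtakes i) (measurable_cylinder N mY G).
      exact: (measurable_cylinder N mY).
    rewrite ler_peMl ?fine_ge0 // /phi ltnNge iG /= ler_pdivlMr // mul1r.
    apply: le_trans (growthNM_ge f_ge1 (deg G 0) f_sum) _.
    by rewrite ler_wpM2l ?(ltW (u_gt0 _)) // v_le.
  - move=> w [t it d0i]; exists t => //; split => //.
    by rewrite size_history.
by rewrite cyl_nil setIT probability_setT /= mulr1 phi_nil.
Qed.

Variable nu : R.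
Hypothesis nu_gt0 : 0 < nu.
Hypothesis mE : forall n : nat, (1 <= n)%N ->
  m n = Num.truncn (1 + (ln n%:R) `^ nu).

(** The exponent in [overtakes_le] is half of the difference estimated in
    [ln_sequence_sum_ge], because v (m i) is at most the exponential of half the
    sum of the 1 / f j for j < m i. *)
Lemma overtakes_eventually_le : exists i1 : nat, (0 < i1)%N /\
  forall i : nat, (i1 <= i)%N -> pr (overtakes i) <= kappa^-1 * (i%:R ^+ 2)^-1.
Proof.
have [i1 [i1_gt0 hi1]] := ln_sequence_sum_ge alpha01 nu_gt0 mE.
exists i1; split => // i i1i; have i0 : (0 < i)%N by apply: leq_trans i1i.
have i0R : 0 < i%:R :> R by rewrite ltr0n.
apply: le_trans (overtakes_le i0) _.
rewrite mulrAC mulrC ler_wpM2l ?invr_ge0 ?(ltW kappa_gt0) //.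
have s0 : 0 < 1 - alpha by rewrite subr_gt0.
have s1 : 1 - alpha <= 1 by rewrite gerBl ltW.
have born : \sum_(j < m i) (f j)^-1 <= 2 / (1 - alpha) * (m i)%:R `^ (1 - alpha).
  have := sum_powR_bound (m i) s0 s1; rewrite opprB addrC subrK.
  by under [in X in _ -> X]eq_bigr do rewrite fE.
have clock : clock_from i 0 =
    \sum_(1 <= n < i.+1) (m n)%:R `^ (1 - alpha) / (4 * n%:R).
  rewrite /clock_from (sum_sender m_gt0 (fun n => (weight_bound n)^-1)).
  apply: eq_big_nat => n /andP [n0 _].
  have mn : 0 < (m n)%:R :> R by rewrite ltr0n m_gt0.
  have n0R : 0 < n%:R :> R by rewrite ltr0n.
  rewrite powRB ?(gt_eqF mn) ?implybT // powRr1 ?(ltW mn) // /weight_bound.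
  by field; rewrite !gt_eqF ?powR_gt0.
have -> : (i%:R ^+ 2)^-1 = expR (- (2 * ln i%:R)) :> R.
  by rewrite expRN mulrC expRM_natr lnK.
apply: le_trans (_ : expR (1 / 2 * \sum_(j < m i) (f j)^-1) *
    expR (- (1 / 2 * clock_from i 0)) <= _).
  by rewrite ler_wpM2r ?expR_ge0 // growth_le_expR //; lra.
rewrite -expRD ler_expR clock; have := hi1 i i1i; lra.
Qed.

(** The bounds are a multiple of 1 / i ^ 2, so Borel-Cantelli applies. *)
Lemma overtakes_finitely : {ae P, forall w, exists i0 : nat,
  forall i t, (i0 <= i)%N -> (arcs_upto m i <= t)%N ->
    (deg (history t w) i < deg (history t w) 0)%N}.
Proof.
have [i1 [i1_gt0 hi1]] := overtakes_eventually_le.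
pose F k := overtakes (k + i1).
have mF k : measurable (F k) by exact: measurable_overtakes.
have F_le k : (P (F k) <= (kappa^-1 * ((k%:R + 1) `^ 2)^-1)%:E)%E.
  rewrite -[leLHS]fineK ?fin_num_measure // lee_fin.
  apply: le_trans (hi1 _ (leq_addl _ _)) _.
  rewrite ler_wpM2l ?invr_ge0 ?(ltW kappa_gt0) //.
  have i0 : (0 < k + i1)%N by rewrite addn_gt0 i1_gt0 orbT.
  rewrite (powR_mulrn 2) ?addr_ge0 //.
  rewrite lef_pV2 ?posrE ?exprn_gt0 ?ltr0n ?ltr_wpDl //.
  by rewrite lerXn2r ?nnegrE ?addr_ge0 // natr1 ler_nat -addn1 leq_add2l.
have sum_lt : (\sum_(k <oo) P (F k) < +oo)%E.
  apply: le_lt_trans (ltry (kappa^-1 * (1 + (2 - 1)^-1))).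
  apply: lime_le; first exact: is_cvg_nneseries.
  apply: nearW => n; apply: le_trans (lee_sum _ (fun k _ => F_le k)) _.
  rewrite sumEFin lee_fin -mulr_sumr ler_wpM2l ?invr_ge0 ?(ltW kappa_gt0) //.
  by rewrite big_mkord; apply: sum_powRN_bound; lra.
have mlim : measurable (lim_sup_set F).
  apply: bigcap_measurableType => n _; apply: bigcup_measurable => k _.
  exact: mF.
have lim0 := (negligibleP P mlim).2 (lim_sup_set_cvg0 mF sum_lt).
apply: negligibleS lim0.
move=> w /= often n _; apply: contrapT => none; apply: often.
exists (n + i1)%N => i t ni it; rewrite ltnNge; apply/negP => le0.
have i1i : (i1 <= i)%N by apply: leq_trans ni; rewrite leq_addl.
apply: none; exists (i - i1)%N; first by rewrite /= leq_subRL // addnC.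
by rewrite /F subnK //; exists t.
Qed.

End late_vertices.

(** * The persistent hub *)

Lemma eventual_leader (D : nat -> nat -> nat) (k : nat) :
  (forall i j, i != j -> exists s,
     (forall t, (s <= t)%N -> (D i t <= D j t)%N) \/
     (forall t, (s <= t)%N -> (D j t <= D i t)%N)) ->
  exists v s, (v <= k)%N /\
    forall t u, (s <= t)%N -> (u <= k)%N -> (D u t <= D v t)%N.
Proof.
move=> ordered; elim: k => [|k [v [s [vk lead]]]].
  by exists 0%N, 0%N; split => // t u _; rewrite leqn0 => /eqP ->.
have [s' [vk1|k1v]] := ordered v k.+1 (negbT (ltn_eqF (vk : (v < k.+1)%N))).
  exists k.+1, (maxn s s'); split => // t u; rewrite geq_max => /andP [st s't].
  rewrite leq_eqVlt => /orP [/eqP -> //|uk].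
  exact: leq_trans (lead t u st uk) (vk1 t s't).
exists v, (maxn s s'); split=> [|t u]; first exact: leqW.
rewrite geq_max => /andP [st s't].
rewrite leq_eqVlt => /orP [/eqP ->|uk]; [exact: k1v|exact: lead].
Qed.

(** An event of the form that the graph before an edge equals G is a cylinder of
    the edge clock; if it is null, so is its extension by one arc. *)
Lemma attachment_process_step d (T : measurableType d) (R : realType)
    (P : probability T R) (f : nat -> R) (m : nat -> nat)
    (X : nat -> nat -> {RV P >-> nat}) (G : multigraph) (i : nat) :
  (forall n, (0 < n)%N -> (0 < m n)%N) -> attachment_process f m X ->
  (i < sender m (size G))%N ->
  let cyl := cylinder (sender m) (arc_target m X) in
  fine (P (cyl (extend (sender m) G i))) =
    attach_prob f G (sender m (size G)) i * fine (P (cyl G)).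
Proof.
move=> m_gt0 process iN cyl.
have [n0 k_lt _] := slotP m_gt0 (size G).
have past : cyl G = [set w | graph_before m (fun a b => X a b w)
    (slot m (size G)).1 (slot m (size G)).2 = G]%classic.
  apply/seteqP; split => w; rewrite /cyl /cylinder /=.
    by rewrite (@history_graph_before _ m_gt0 _ (fun a b => X a b)).
  by rewrite (@history_graph_before _ m_gt0 _ (fun a b => X a b)).
have mY t l : measurable (arc_target m X t @^-1` [set l])%classic.
  rewrite -[X in measurable X]setTI; exact: measurable_funP.
have [P0|] := eqVneq (P (cyl G)) 0%E.
  rewrite /cyl cylinder_extend -/(cyl G) P0 mulr0.
  suff -> : P (cyl G `&` arc_target m X (size G) @^-1` [set i])%classic = 0%E by [].
  apply/eqP; rewrite eq_le measure_ge0 andbT -P0.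
  apply: le_measure; rewrite ?inE; [|exact: measurable_cylinder|exact: subIsetl].
  by apply: measurableI => //; exact: measurable_cylinder.
rewrite -measure_gt0 => P_gt0.
have := process (slot m (size G)).1 (slot m (size G)).2 G i n0 k_lt iN.
rewrite /= -past => /(_ P_gt0) <-; rewrite /cond_prob divfK.
  by rewrite /cyl cylinder_extend setIC.
rewrite gt_eqF // -lte_fin fineK // fin_num_measure //.
exact: measurable_cylinder.
Qed.

Theorem theorem4p7 (R : realType) (alpha nu : R)
    (d : measure_display) (T : measurableType d) (P : probability T R)
    (f : nat -> R) (m : nat -> nat) (X : nat -> nat -> {RV P >-> nat}) :
  1 / 2 < alpha < 1 ->
  0 < nu ->
  (forall k : nat, f k = (k%:R + 1) `^ alpha) ->
  (forall n : nat, (1 <= n)%N -> m n = Num.truncn (1 + (ln n%:R) `^ nu)) ->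
  attachment_process f m X ->
  persistent_hub P (random_graph m X).
Proof.
move=> /andP [alpha_gt alpha_lt1] nu_gt0 fE mE process.
have alpha01 : 0 < alpha < 1 by apply/andP; split => //; lra.
have m_gt0 n : (0 < n)%N -> (0 < m n)%N.
  by move=> n0; rewrite mE // truncn_gt0 lerDl powR_ge0.
have m_homo l n : (0 < l)%N -> (l <= n)%N -> (m l <= m n)%N.
  move=> l0 ln; have n0 : (0 < n)%N by apply: leq_trans ln.
  rewrite !mE //; apply: le_truncn; rewrite lerD2l.
  apply: ge0_ler_powR; rewrite ?nnegrE ?ln_ge0 ?ler1n ?(ltW nu_gt0) //.
  by rewrite ler_ln ?posrE ?ltr0n // ler_nat.
have f_sum n : \sum_(j < n) (f j ^+ 2)^-1 <= 1 + (alpha * 2 - 1)^-1.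
  under eq_bigr do rewrite fE -powR_mulrn ?powR_ge0 // -powRrM.
  by apply: sum_powRN_bound; lra.
have f_ge1 k : 1 <= f k.
  rewrite fE -[leLHS](powRr0 (k%:R + 1)); apply: ler_powR; last lra.
  by rewrite lerDr.
have mY t i : measurable (arc_target m X t @^-1` [set i])%classic.
  rewrite -[X in measurable X]setTI; exact: measurable_funP.
have N_gt0 t : (0 < sender m t)%N by case: (slotP m_gt0 t).
have stepE G i : (i < sender m (size G))%N ->
    fine (P (cylinder (sender m) (arc_target m X) (extend (sender m) G i))) =
    attach_prob f G (sender m (size G)) i *
      fine (P (cylinder (sender m) (arc_target m X) G)).
  exact: attachment_process_step.
pose D w i t := deg (history (sender m) (arc_target m X) t w) i.
have challengers : {ae P, forall w, exists i0 : nat,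
    forall i t, (i0 <= i)%N -> (arcs_upto m i <= t)%N -> (D w i t < D w 0 t)%N}.
  exact: (overtakes_finitely alpha01 fE m_gt0 m_homo mY stepE f_sum nu_gt0 mE).
have ordered : {ae P, forall w, forall i j, i != j -> exists s,
    (forall t, (s <= t)%N -> (D w i t <= D w j t)%N) \/
    (forall t, (s <= t)%N -> (D w j t <= D w i t)%N)}.
  apply: ae_foralln => i; apply: ae_foralln => j.
  have [->|ij] := eqVneq i j; first by apply: aeW.
  have sent l t : (arcs_upto m (maxn i j) <= t)%N -> (l <= maxn i j)%N ->
      (l < sender m t)%N.
    by move=> ht lij; rewrite (leq_ltn_trans lij) // ltnNge sender_leE // -leqNgt.
  have := pair_eventually_ordered f_ge1 N_gt0 mY stepE f_sum ij
    (fun t ht => sent i t ht (leq_maxl i j)) (fun t ht => sent j t ht (leq_maxr i j)).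
  by apply: filterS => w h _.
apply: filterS2 challengers ordered => w [i0 late] order.
have [v [s [vi0 lead]]] := eventual_leader i0 order.
exists (maxn s i0), v => n; rewrite geq_max => /andP [sn i0n].
have -> : random_graph m X n w =
    history (sender m) (arc_target m X) (arcs_upto m n) w.
  by rewrite (history_graph m_gt0 (fun a b => X a b)).
have sM : (s <= arcs_upto m n)%N by rewrite (leq_trans sn) ?arcs_upto_ge.
split=> [|u un]; first exact: leq_trans i0n.
have [ui0|i0u] := leqP u i0; first exact: lead.
apply: leq_trans (lead _ 0%N sM (leq0n _)); apply: ltnW.
apply: late; first exact: ltnW.
by rewrite leqNgt arcs_upto_lt // -leqNgt.
Qed.
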